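(* Let $\Gamma$ be a locally $\Sigma$ graph, where $\Sigma$ is a strongly regular graph with $\mu(\Sigma)>0$ in which every $\mu$-graph is isomorphic to $2\cdot K_1$. Then $\Gamma$ has the unique $x$ property.
   Context: All graphs are undirected and simple with non-empty vertex set $V\Gamma$. For $u\in V\Gamma$, $\Gamma_i(u)$ is the set of vertices at distance $i$ from $u$, and $\Gamma(u)=\Gamma_1(u)$. A graph $\Gamma$ is locally $\Sigma$ if the neighbourhood of every vertex of $\Gamma$ is non-empty and induces a graph isomorphic to $\Sigma$. A strongly regular graph with parameters $(v,k,\lambda,\mu)$ is a finite graph of order $v$, regular of valency $k$ with $0<k<v-1$, in which any two adjacent vertices have $\lambda=\lambda(\Sigma)$ common neighbours and any two distinct non-adjacent vertices have $\mu=\mu(\Sigma)$ common neighbours. A $\mu$-graph of $\Sigma$ is a subgraph induced by $\Sigma(u)\cap\Sigma(w)$ for some vertices $u,w$ at distance two in $\Sigma$. $2\cdot K_1$ is the edgeless graph on two vertices. A non-complete graph $\Gamma$ has the unique $x$ property if for some $u\in V\Gamma$, $v\in\Gamma(u)$ and $w\in\Gamma_2(u)\cap\Gamma(v)$, there exists a unique $x\in\Gamma(u)\cap\Gamma_2(v)$ such that $\Gamma(u)\cap\Gamma(v)\cap\Gamma(w)=\Gamma(u)\cap\Gamma(v)\cap\Gamma(x)$. *)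

(* Defs.v *)
From mathcomp Require Import all_boot.
From mathcomp Require Import boolp classical_sets functions cardinality.

Set Implicit Arguments.
Unset Strict Implicit.
Unset Printing Implicit Defensive.

Local Open Scope classical_set_scope.
Local Open Scope card_scope.

(* The vertex set may be infinite. *)
Record graph : Type := Graph {
  vertex :> Type;
  adj : vertex -> vertex -> Prop;
  adj_sym : forall x y, adj x y -> adj y x;
  adj_irr : forall x, ~ adj x x;
  vertex_neq0 : [set: vertex] !=set0 }.

Definition complete (G : graph) : Prop :=
  forall x y : G, x <> y -> adj x y.

Definition isomorphic (G H : graph) : Prop :=
  exists2 f : G -> H, bijective f & forall x y, adj x y <-> adj (f x) (f y).

Fact induced_sym (G : graph) (A : set G) (x y : A) :
  adj (val x) (val y) -> adj (val y) (val x).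
Proof. exact: adj_sym. Qed.

Fact induced_irr (G : graph) (A : set G) (x : A) : ~ adj (val x) (val x).
Proof. exact: adj_irr. Qed.

Fact induced_neq0 (G : graph) (A : set G) (A0 : A !=set0) : [set: A] !=set0.
Proof. by case: A0 => a Aa; exists (exist _ a (mem_set Aa)). Qed.

(* Graphs have at least one vertex, so inducing needs a proof that the vertex
   subset is non-empty. *)
Definition induced (G : graph) (A : set G) (A0 : A !=set0) : graph :=
  Graph (@induced_sym G A) (@induced_irr G A) (induced_neq0 A0).

Fact edgeless_sym (T : Type) (x y : T) : False -> False.
Proof. by []. Qed.

Fact edgeless_irr (T : Type) (x : T) : ~ False.
Proof. by []. Qed.

Fact bool_neq0 : [set: bool] !=set0.
Proof. by exists true. Qed.

Definition two_K1 : graph :=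
  @Graph bool (fun _ _ => False)
    (@edgeless_sym bool) (@edgeless_irr bool) bool_neq0.

Fixpoint walk (G : graph) (n : nat) (u w : G) : Prop :=
  if n is m.+1 then exists2 z, adj u z & walk m z w else u = w.

(* The vertices at distance [i] from [u]. *)
Definition sphere (G : graph) (i : nat) (u : G) : set G :=
  [set w | walk i u w /\ forall j, j < i -> ~ walk j u w].

Definition nbrs (G : graph) (u : G) : set G := [set w | adj u w].

Lemma sphere1 (G : graph) (u : G) : sphere 1 u = nbrs u.
Proof.
apply/seteqP; split=> w /=; first by case=> -[z uz <-].
move=> uw; split; first by exists w.
by case=> // _ /= euw; apply: (@adj_irr G w); rewrite -{1}euw.
Qed.

Definition is_locally (G S : graph) : Prop :=
  forall u : G, exists u0 : nbrs u !=set0, isomorphic (induced u0) S.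

Definition strongly_regular (S : graph) (v k lambda mu : nat) : Prop :=
  [/\ [set: S] #= `I_v,
      0 < k < v - 1,
      forall x : S, nbrs x #= `I_k,
      forall x y : S, adj x y -> nbrs x `&` nbrs y #= `I_lambda
    & forall x y : S, x <> y -> ~ adj x y -> nbrs x `&` nbrs y #= `I_mu].

Definition is_mu_graph (S M : graph) : Prop :=
  exists (u w : S) (uw0 : nbrs u `&` nbrs w !=set0),
    sphere 2 u w /\ M = induced uw0.

Definition unique_x_property (G : graph) : Prop :=
  ~ complete G /\
  exists u v w : G,
    [/\ nbrs u v, (sphere 2 u `&` nbrs v) w
      & exists! x : G, (nbrs u `&` sphere 2 v) x /\
          nbrs u `&` nbrs v `&` nbrs w = nbrs u `&` nbrs v `&` nbrs x].

(* Main.v *)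
Require Import Defs.
From mathcomp Require Import all_boot finmap.
From mathcomp Require Import boolp classical_sets functions cardinality.

(* Let u, w be distinct non-adjacent neighbours of q. In the graph induced on
   the neighbours of q, the common neighbours of u and w form a non-adjacent
   pair {y, z}; in the graph induced on the neighbours of u, the common
   neighbours of y and z form a non-adjacent pair {q, x}. Then x is the unique
   vertex required for the triple (u, q, w): in the neighbourhood of u, the two
   common neighbours of q and x are y and z, and any other candidate would be a
   common neighbour of y and z. *)

Set Implicit Arguments.
Unset Strict Implicit.
Unset Printing Implicit Defensive.

Local Open Scope classical_set_scope.
Local Open Scope card_scope.

(* The set form of "every mu-graph is 2.K_1", for graphs with mu > 0. *)
Definition mu_graphs_2K1 (G : graph) : Prop :=
  forall s t : G, s <> t -> ~ adj s t ->
    exists a b, [/\ nbrs s `&` nbrs t = [set a; b], a <> b & ~ adj a b].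

Lemma isomorphic_sym (G H : graph) : isomorphic G H -> isomorphic H G.
Proof.
move=> [f [g fK gK] fadj]; exists g; first by exists f.
by move=> x y; rewrite fadj !gK.
Qed.

Lemma isomorphic_complete (G H : graph) :
  isomorphic G H -> complete G -> complete H.
Proof.
move=> /isomorphic_sym[f /bij_inj finj fadj] cG x y xy.
by apply/fadj/cG => /finj.
Qed.

Lemma isomorphic_mu_graphs_2K1 (G H : graph) :
  isomorphic G H -> mu_graphs_2K1 G -> mu_graphs_2K1 H.
Proof.
move=> /isomorphic_sym[f [g fK gK] fadj] muG s t st nst.
have [||a [b [eab ab nab]]] := muG (f s) (f t).
- by move=> /(can_inj fK).
- by move=> /fadj.
exists (g a), (g b); split.
- apply/seteqP; split=> x.
    move=> [/fadj sx /fadj tx].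
    have : [set a; b] (f x) by rewrite -eab.
    by case=> <-; [left | right]; rewrite fK.
  move=> xab; have : [set a; b] (f x).
    by case: xab => ->; [left | right]; rewrite gK.
  by rewrite -eab => -[sx tx]; split; apply/fadj.
- by move=> /(can_inj gK).
- by rewrite fadj !gK.
Qed.

Lemma sphere2P (G : graph) (u w : G) :
  sphere 2 u w <->
    [/\ u <> w, ~ adj u w & exists z, adj u z /\ adj z w].
Proof.
split=> [[[z uz [z' zz' <-]] far]|[uw nuw [z [uz zw]]]].
  split; first exact: (far 0).
  - by move=> uw; apply: (far 1) => //; exists z'.
  - by exists z.
split; first by exists z => //; exists w.
by case=> [|[|//]] _ //= -[y uy yw]; apply: nuw; rewrite -yw.
Qed.

Lemma card_eq_setU1 (T : Type) (A : set T) (x : T) (n : nat) :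
  ~ A x -> A #= `I_n -> x |` A #= `I_n.+1.
Proof.
(* Retyping [A] over [{classic T}] gives the choice structure that finite sets require. *)
move=> Ax cardA; pose B : set {classic T} := A.
have cardB : B #= `I_n by [].
have finB : finite_set B by apply/finite_setP; exists n.
have finxB : finite_set ((x : {classic T}) |` B) by rewrite finite_setU.
have := fset_setK finxB; rewrite fset_setU1// => <-.
apply/(@card_eq_fsetP {classic T}).
by rewrite cardfsU1 in_fset_set// memNset// (card_fset_set cardB).
Qed.

(** In a complete graph a vertex and its neighbours exhaust the graph, so [v = k.+1], against
    [k < v - 1]. *)
Lemma strongly_regular_not_complete (S : graph) (v k lambda mu : nat) :
  strongly_regular S v k lambda mu -> ~ complete S.
Proof.
move=> [cardS /andP[_ kv] valency _ _] cS.
have [x _] := vertex_neq0 S.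
have SE : [set: S] = x |` nbrs x.
  apply/seteqP; split=> // y _.
  by have [->|yx] := EM (y = x); [left | right; apply/cS/nesym].
have : `I_v #= `I_k.+1.
  rewrite -(card_eql cardS) SE.
  exact: card_eq_setU1 (@adj_irr S x) (valency x).
by move=> /card_eq_II vE; rewrite vE subn1 ltnn in kv.
Qed.

(** As [mu] is positive, distinct non-adjacent vertices have a common neighbour; they are thus at
    distance two and their common neighbours induce a mu-graph. *)
Lemma strongly_regular_mu_graphs_2K1 (S : graph) (v k lambda mu : nat) :
  strongly_regular S v k lambda mu -> 0 < mu ->
  (forall M : graph, is_mu_graph S M -> isomorphic M two_K1) ->
  mu_graphs_2K1 S.
Proof.
move=> [_ _ _ _ cardmu] mu_gt0 mu2K1 s t st nst.
have st0 : nbrs s `&` nbrs t !=set0.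
  apply/set0P/negP => /eqP e; move: (cardmu _ _ st nst).
  by rewrite e card_eq_sym card_eq0 => /eqP/IIn_eq0 mu0; rewrite mu0 in mu_gt0.
have [|f [g fK gK] fadj] := mu2K1 (induced st0).
  exists s, t, st0; split=> //; apply/sphere2P; split=> //.
  by case: st0 => z [sz tz]; exists z; split=> //; exact: adj_sym.
exists (val (g true)), (val (g false)); split.
- apply/seteqP; split=> [x sx|x].
    rewrite -[x]/(val (exist _ x (mem_set sx) : nbrs s `&` nbrs t)).
    set y := exist _ _ _.
    by rewrite -(fK y); case: (f y); [left | right].
  by case=> ->; exact: set_valP.
- by move=> /val_inj /(can_inj gK).
- by move=> /(fadj _ _).1.
Qed.

(** Within the graph induced on [nbrs p], the common neighbours of [s] and [t] are exactly this
    triple intersection. *)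
Lemma locally_mu_pair (G S : graph) : is_locally G S -> mu_graphs_2K1 S ->
  forall p s t : G, adj p s -> adj p t -> s <> t -> ~ adj s t ->
  exists a b,
    [/\ nbrs p `&` nbrs s `&` nbrs t = [set a; b], a <> b & ~ adj a b].
Proof.
move=> locG muS p s t ps pt st nst.
have [p0 /isomorphic_sym /isomorphic_mu_graphs_2K1 /(_ muS) mup] := locG p.
pose s' : induced p0 := exist _ s (mem_set ps).
pose t' : induced p0 := exist _ t (mem_set pt).
have st' : s' <> t' by move=> /(congr1 val).
have [a [b [eab ab nab]]] := mup s' t' st' nst.
exists (val a), (val b); split=> //.
- apply/seteqP; split=> [x [[px sx] tx]|x].
    pose x' : induced p0 := exist _ x (mem_set px).
    have : [set a; b] x' by rewrite -eab.
    by case=> <-; [left | right].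
  move=> xab.
  have [y yab ->] : exists2 y, [set a; b] y & x = val y.
    by case: xab => ->; [exists a | exists b] => //; [left | right].
  by move: yab; rewrite -eab => -[sy ty]; split=> //; split=> //; exact: set_valP.
- by move=> /val_inj.
Qed.

Lemma locally_not_complete (G S : graph) : is_locally G S -> ~ complete S ->
  exists p s t : G, [/\ adj p s, adj p t, s <> t & ~ adj s t].
Proof.
move=> locG ncS; have [p _] := vertex_neq0 G.
have [p0 isoS] := locG p.
apply: contrapT => nex; apply: ncS; apply: isomorphic_complete isoS _ => s t st.
apply: contrapT => nst; apply: nex; exists p, (val s), (val t).
split=> //; [exact: set_valP|exact: set_valP|].
by move=> /val_inj.
Qed.

Theorem lemma4p1 (Gamma Sigma : graph) (v k lambda mu : nat)
    (hloc : is_locally Gamma Sigma)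
    (hsrg : strongly_regular Sigma v k lambda mu)
    (hmu : 0 < mu)
    (hmug : forall M : graph, is_mu_graph Sigma M -> isomorphic M two_K1) :
  unique_x_property Gamma.
Proof.
have muS := strongly_regular_mu_graphs_2K1 hsrg hmu hmug.
have ncS := strongly_regular_not_complete hsrg.
have [q [u [w [qu qw uw nuw]]]] := locally_not_complete hloc ncS.
have uq := adj_sym qu.
split; first by move=> /(_ _ _ uw).
have [y [z [eyz yz nyz]]] := locally_mu_pair hloc muS qu qw uw nuw.
have [[[qy uy] wy] [[qz uz] wz]] :
    (nbrs q `&` nbrs u `&` nbrs w) y /\ (nbrs q `&` nbrs u `&` nbrs w) z.
  by rewrite eyz; split; [left | right].
have [c [d [ecd cd ncd]]] := locally_mu_pair hloc muS uy uz yz nyz.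
(* Since [q] is itself a common neighbour of [y] and [z] next to [u], it is [c] or [d]; the other
   one serves as [x]. *)
have qcd : [set c; d] q by rewrite -ecd; split; [split|] => //; exact: adj_sym.
have [x [exq qx nqx]] : exists x,
    [/\ nbrs u `&` nbrs y `&` nbrs z = [set q; x], q <> x & ~ adj q x].
  case: qcd => ->; first by exists d.
  exists c; split; [by rewrite setUC | exact: nesym |].
  by move=> /adj_sym.
have [[ux yx] zx] : (nbrs u `&` nbrs y `&` nbrs z) x by rewrite exq; right.
exists u, q, w; split=> //.
  by split=> //; apply/sphere2P; split=> //; exists q.
exists x; split.
  split.
    by split=> //; apply/sphere2P; split=> //; exists u.
  (* Around [u], the vertices [q] and [x] have exactly two common neighbours; the distinct [y] and
     [z] are among them, so they are all of them. *)
  have [a [b [eab ab nab]]] := locally_mu_pair hloc muS uq ux qx nqx.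
  rewrite [nbrs u `&` nbrs q]setIC eyz [nbrs q `&` _]setIC eab.
  have [yab zab] : [set a; b] y /\ [set a; b] z.
    by rewrite -eab; do !split=> //; exact: adj_sym.
  by case: yab yz zab => -> yz [] zE; rewrite zE // setUC in yz *.
move=> x' [[ux' /sphere2P[qx' _ _]]].
rewrite [nbrs u `&` nbrs q]setIC eyz => exx'.
(* The equality of intersections makes [x'] adjacent to [y] and [z], hence equal to [q] or [x];
   being at distance two from [q] excludes [q]. *)
have [[_ x'y] [_ x'z]] : (nbrs q `&` nbrs u `&` nbrs x') y /\
    (nbrs q `&` nbrs u `&` nbrs x') z.
  by rewrite -exx'; split; [left | right].
have : [set q; x] x'.
  by rewrite -exq; split; [split|] => //; exact: adj_sym.
by case=> // x'q; case: qx'.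
Qed.
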